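(* Let $\mathscr{A}$ be a $C^*$-algebra, let $\mathscr{X}$ be a Hilbert $\mathscr{A}$-module, let $x,y_1,\dots,y_n\in\mathscr{X}$ and $a_1,\dots,a_n\in\mathscr{A}$. Then $$\left|\sum_{i=1}^n a_i\langle y_i,x\rangle\right|^2\le |x|^2\sum_{i=1}^n\|a_i\|^2\left[\max_{1\le i\le n}\|y_i\|^2+\left(\sum_{1\le i\neq j\le n}\|\langle y_i,y_j\rangle\|^2\right)^{1/2}\right].$$
   Context: A Hilbert $\mathscr{A}$-module over a $C^*$-algebra $\mathscr{A}$ is a complex linear space $\mathscr{X}$ that is a right $\mathscr{A}$-module with compatible scalar multiplication ($\lambda(xa)=x(\lambda a)=(\lambda x)a$), equipped with an $\mathscr{A}$-valued inner product $\langle\cdot,\cdot\rangle:\mathscr{X}\times\mathscr{X}\to\mathscr{A}$ satisfying: $\langle x,x\rangle\ge 0$, with $\langle x,x\rangle=0$ iff $x=0$; $\langle x,\lambda y+z\rangle=\lambda\langle x,y\rangle+\langle x,z\rangle$; $\langle x,ya\rangle=\langle x,y\rangle a$; $\langle x,y\rangle^*=\langle y,x\rangle$; and complete for the norm $\|x\|=\|\langle x,x\rangle\|^{1/2}$. (The inner product is thus linear in the second variable and conjugate-linear in the first.) For $x\in\mathscr{X}$, $|x|=\langle x,x\rangle^{1/2}\in\mathscr{A}$; for $a\in\mathscr{A}$, $|a|=(a^*a)^{1/2}$. Inequalities are in the usual order on self-adjoint elements of $\mathscr{A}$: $a\le b$ iff $b-a$ is positive. The sum over $1\le i\neq j\le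 n$ runs over all ordered pairs $(i,j)$ with $i\neq j$. *)

(* Defs.v *)
From HB Require Import structures.
From mathcomp Require Import all_boot all_order all_algebra.
From mathcomp Require Import complex.
From mathcomp Require Import all_classical all_reals all_analysis.
Set Implicit Arguments.
Unset Strict Implicit.
Unset Printing Implicit Defensive.
Import Order.TTheory GRing.Theory Num.Theory.
Import numFieldNormedType.Exports.
Local Open Scope classical_set_scope.
Local Open Scope ring_scope.

(* C*-algebras are not assumed to be unital, so the product is a field of the
   mixin instead of the multiplication of a ring structure.  The norm `|a| takes
   its values in R[i], where 0 <= z means that z is real and nonnegative; norms
   are therefore pairwise comparable although the order of R[i] is partial. *)
HB.mixin Record NormedModule_isCStarAlgebra (R : realType) A
    of CompleteNormedModule R[i] A := {
  cmul : A -> A -> A;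
  star : A -> A;
  cmulA : forall a b c : A, cmul a (cmul b c) = cmul (cmul a b) c;
  cmul_linearl : forall (k : R[i]) (a b c : A),
    cmul (k *: a + b) c = k *: cmul a c + cmul b c;
  cmul_linearr : forall (k : R[i]) (a b c : A),
    cmul c (k *: a + b) = k *: cmul c a + cmul c b;
  ler_norm_cmul : forall a b : A, `|cmul a b| <= `|a| * `|b|;
  starK : forall a : A, star (star a) = a;
  star_antilinear : forall (k : R[i]) (a b : A),
    star (k *: a + b) = k^* *: star a + star b;
  star_cmul : forall a b : A, star (cmul a b) = cmul (star b) (star a);
  cstar_identity : forall a : A, `|cmul (star a) a| = `|a| ^+ 2
}.

#[short(type="cstarAlgType")]
HB.structure Definition CStarAlgebra (R : realType) :=
  {A of NormedModule_isCStarAlgebra R A & CompleteNormedModule R[i] A}.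

Declare Scope cstar_scope.
Delimit Scope cstar_scope with cstar.
Notation "a ** b" := (cmul a b) (at level 40, left associativity) : cstar_scope.
Notation "a ^`*" := (star a) (at level 1, format "a ^`*") : cstar_scope.
Local Open Scope cstar_scope.

Section Positivity.
Context {R : realType} {A : cstarAlgType R}.

(* The pair (a, k) stands for the element a + k 1 of the unitization of A. *)
Definition unitization_mul (u v : A * R[i]) : A * R[i] :=
  (u.1 ** v.1 + u.2 *: v.1 + v.2 *: u.1, u.2 * v.2).

Definition unitization_one : A * R[i] := (0, 1).

Definition unitization_invertible (u : A * R[i]) : Prop :=
  exists v : A * R[i], unitization_mul u v = unitization_one /\
                       unitization_mul v u = unitization_one.

(* The spectrum is always taken in the unitization.  When A already has a unit,
   this adds at most the point 0 to the spectrum relative to A, so positivity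
   is the same for both. *)
Definition spectrum (a : A) : set R[i] :=
  [set k | ~ unitization_invertible (- a, k)].

Definition positive (a : A) : Prop :=
  a^`* = a /\ forall k, spectrum a k -> 0 <= k.

Definition cstar_le (a b : A) : Prop := positive (b - a).

(* A positive element of a C*-algebra has exactly one positive square root; the
   default value 0 is only taken when a is not positive. *)
Definition cstar_sqrt (a : A) : A :=
  xget 0 [set b | positive b /\ b ** b = a].

Definition cstar_abs (a : A) : A := cstar_sqrt (a^`* ** a).

Definition cstar_sqr (a : A) : A := a ** a.

End Positivity.

Notation "a <=* b" := (cstar_le a b) (at level 70) : cstar_scope.

(* Completeness and the complex vector space structure come from
   CompleteNormedModule; norm_inner says that its norm is the one induced by the
   inner product.  There is no axiom for a unit, since A need not have one. *)
HB.mixin Record NormedModule_isHilbertModule (R : realType)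
    (A : cstarAlgType R) X of CompleteNormedModule R[i] X := {
  act : X -> A -> X;
  inner : X -> X -> A;
  actDl : forall (x y : X) (a : A), act (x + y) a = act x a + act y a;
  actDr : forall (x : X) (a b : A), act x (a + b) = act x a + act x b;
  actA : forall (x : X) (a b : A), act (act x a) b = act x (a ** b);
  scaler_act : forall (k : R[i]) (x : X) (a : A),
    k *: act x a = act x (k *: a);
  scalel_act : forall (k : R[i]) (x : X) (a : A),
    k *: act x a = act (k *: x) a;
  inner_ge0 : forall x : X, positive (inner x x);
  inner_eq0 : forall x : X, inner x x = 0 <-> x = 0;
  inner_linearr : forall (k : R[i]) (x y z : X),
    inner x (k *: y + z) = k *: inner x y + inner x z;
  inner_act : forall (x y : X) (a : A), inner x (act y a) = inner x y ** a;
  inner_star : forall x y : X, (inner x y)^`* = inner y x;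
  norm_inner : forall x : X, `|x| = sqrtC `|inner x x|
}.

#[short(type="hilbertModType")]
HB.structure Definition HilbertModule (R : realType) (A : cstarAlgType R) :=
  {X of NormedModule_isHilbertModule R A X & CompleteNormedModule R[i] X}.

Definition hilbert_abs {R : realType} {A : cstarAlgType R}
  {X : hilbertModType A} (x : X) : A := cstar_sqrt (inner x x).

(* Main.v *)
Require Import Defs.
From HB Require Import structures.
From mathcomp Require Import all_boot all_order all_algebra.
From mathcomp Require Import complex.
From mathcomp Require Import all_classical all_reals all_analysis.
From mathcomp Require Import ring lra.
Import Order.TTheory GRing.Theory Num.Theory.
Import numFieldNormedType.Exports.
Local Open Scope ring_scope.
Local Open Scope cstar_scope.

(** The left-hand side is a value of the inner product with a single vector:
[\sum_i a i ** inner (y i) x = inner z x] for [z = \sum_i act (y i) (a i)^`*].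
Expanding [inner z z] as a double sum and bounding it term by term shows that its
norm is at most the constant [K] of the theorem ([rnorm_inner_sum]), so what
remains is the Cauchy-Schwarz inequality
[b^* b <= K <x, x>] for [b = inner z x].

After scaling, [c = inner z z] has norm at most one.  The Cauchy-Schwarz
inequality is proved by exhibiting a vector [u] with
[<u, u> = <x, x> - b^* b], namely [u = x - z f b] where [f] is the self-adjoint
solution of [2 f = 1 + f c f] in the unitization ([cauchy_schwarz_defect]).  The
positivity of the difference is then an axiom of Hilbert modules, and no sum of
positive elements has to be compared.  The solution [f] is found by iteration: a
scalar quadratic map majorizes the iteration ([majorant_fixpoint]), and this works
even for norm one, where the iteration is not a contraction.

The other half of the proof shows that [hilbert_abs x], defined by choosing a
positive square root of [inner x x], does have the square [inner x x]: a positive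
element, in the sense of the spectrum, has a positive square root ([exists_sqrt]).
The main point is that the norm of a self-adjoint element belongs to its spectrum
up to sign ([not_invertible_1Bsqr]); this has an algebraic proof by geometric
sums.  Together with the factorization of complex polynomials, it bounds the norm
of [q(a)], for a positive contraction [a] and a real polynomial [q] without
constant term, by the maximum of [`|q|] on the unit interval ([rnorm_acalc_le]).
Polynomials that converge uniformly to the square root then converge in the
algebra when evaluated at [a]. *)

Set Implicit Arguments.
Unset Strict Implicit.
Unset Printing Implicit Defensive.

(** * Norms with real values *)

(** The norm takes values in the partially ordered field [R[i]]; its real part
carries the same information and lives in an ordered field. *)
Definition rnorm {R : realType} {V : normedModType R[i]} (v : V) : R :=
  complex.Re `|v|.

Section RealNorm.
Context {R : realType} {V : normedModType R[i]}.
Implicit Types (u v : V) (k : R[i]).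

Lemma rnormE v : `|v| = (rnorm v)%:C%C.
Proof. by rewrite /rnorm RRe_real ?normr_real. Qed.

Lemma rnorm_ge0 v : 0 <= rnorm v.
Proof. by rewrite -lecR -rnormE normr_ge0. Qed.

Lemma rnorm_eq0 v : rnorm v = 0 -> v = 0.
Proof. by move=> v0; apply/eqP; rewrite -normr_eq0 rnormE v0. Qed.

Lemma rnorm0 : rnorm (0 : V) = 0.
Proof. by rewrite /rnorm normr0. Qed.

Lemma rnormN v : rnorm (- v) = rnorm v.
Proof. by rewrite /rnorm normrN. Qed.

Lemma rnormC u v : rnorm (u - v) = rnorm (v - u).
Proof. by rewrite -rnormN opprB. Qed.

Lemma ler_rnormD u v : rnorm (u + v) <= rnorm u + rnorm v.
Proof. by rewrite -lecR rmorphD /= -!rnormE ler_normD. Qed.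

Lemma ler_rnormB u v : rnorm (u - v) <= rnorm u + rnorm v.
Proof. by rewrite -(rnormN v) ler_rnormD. Qed.

Lemma ler_rnorm_sum (I : Type) (r : seq I) (P : pred I) (F : I -> V) :
  rnorm (\sum_(i <- r | P i) F i) <= \sum_(i <- r | P i) rnorm (F i).
Proof.
elim/big_ind2: _ => [|a x b y ax by_|//]; first by rewrite rnorm0.
by rewrite (le_trans (ler_rnormD _ _)) // lerD.
Qed.

Lemma rnormZ (c : R) v : 0 <= c -> rnorm (c%:C%C *: v) = c * rnorm v.
Proof.
move=> c0; apply: (@complexI R); rewrite -rnormE normrZ rnormE rmorphM /=.
by rewrite ger0_norm // lecR.
Qed.

Lemma Re_norm_ge0 k : 0 <= complex.Re `|k|.
Proof. by have := normr_ge0 k; rewrite lecE => /andP[]. Qed.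

Lemma rnormZ_complex k v : rnorm (k *: v) = complex.Re `|k| * rnorm v.
Proof.
apply: (@complexI R); rewrite -rnormE normrZ rnormE rmorphM /=.
by rewrite RRe_real // normr_real.
Qed.

Lemma cvg_rnorm (u : nat -> V) l :
  (u n @[n --> \oo] --> l)%classic <->
  (rnorm (u n - l) @[n --> \oo] --> (0 : R))%classic.
Proof.
split.
- move=> /cvgrPdist_le ul; apply/cvgrPdist_le => e e0.
  have /ul : 0 < e%:C%C by rewrite ltcR.
  apply: filterS => n; rewrite rnormE lecR rnormC => un.
  by rewrite sub0r normrN ger0_norm ?rnorm_ge0.
- move=> /cvgrPdist_le ul; apply/cvgrPdist_le => e e0.
  have eE : e = (complex.Re e)%:C%C by rewrite RRe_real // realE ltW.
  have e1 : 0 < complex.Re e by rewrite -ltcR -eE.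
  have := ul _ e1; apply: filterS => n.
  by rewrite sub0r normrN ger0_norm ?rnorm_ge0 // eE rnormE lecR rnormC.
Qed.

Lemma rnorm_squeeze (u : nat -> V) l (e : nat -> R) :
  (forall n, rnorm (u n - l) <= e n) -> (e n @[n --> \oo] --> (0 : R))%classic ->
  (u n @[n --> \oo] --> l)%classic.
Proof.
move=> ue e0; apply/cvg_rnorm.
apply: (@squeeze_cvgr _ _ _ _ (fun=> 0) e) => //; last exact: cvg_cst.
by apply: nearW => n; rewrite rnorm_ge0 ue.
Qed.

Lemma cvg_rnorm_le (u : nat -> V) l (M : R) :
  (u n @[n --> \oo] --> l)%classic -> (forall n, rnorm (u n) <= M) -> rnorm l <= M.
Proof.
move=> /cvg_rnorm/cvgrPdist_le ul uM; apply/ler_addgt0Pr => e /ul [N _ /(_ N)].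
rewrite sub0r normrN ger0_norm ?rnorm_ge0 // => /(_ (leqnn N)) h.
rewrite -[l](subrKC (u N)) (le_trans (ler_rnormD _ _))// lerD //.
by rewrite rnormC.
Qed.

End RealNorm.

Lemma rnorm_cauchy_cvg (R : realType) (V : completeNormedModType R[i])
    (u : nat -> V) (e : nat -> R) :
  (forall n m, rnorm (u (n + m)%N - u n) <= e n) ->
  (e n @[n --> \oo] --> (0 : R))%classic -> cvgn u.
Proof.
move=> ue /cvgrPdist_lt e0; apply/cauchy_cvgP/cauchy_exP => eps eps0.
have eE : eps = (complex.Re eps)%:C%C by rewrite RRe_real // realE ltW.
have e1 : 0 < complex.Re eps by rewrite -ltcR -eE.
have [N _ /(_ N (leqnn N))] := e0 _ e1; rewrite sub0r normrN => eN.
exists (u N); exists N => // n /= Nn.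
rewrite -ball_normE /ball_ /= rnormE eE ltcR rnormC.
rewrite -(subnKC Nn) (le_lt_trans (ue _ _)) // (le_lt_trans _ eN) //.
exact: ler_norm.
Qed.

(** * Elementary calculus in a C*-algebra *)

Section CStarBasics.
Context {R : realType} {A : cstarAlgType R}.
Implicit Types (a b c : A) (k : R[i]).

Lemma cmulDl a b c : (a + b) ** c = a ** c + b ** c.
Proof. by have := cmul_linearl 1 a b c; rewrite !scale1r. Qed.

Lemma cmulDr a b c : a ** (b + c) = a ** b + a ** c.
Proof. by have := cmul_linearr 1 b c a; rewrite !scale1r. Qed.

Lemma cmul0l a : 0 ** a = 0.
Proof. by apply: (@addrI _ (0 ** a)); rewrite -cmulDl !addr0. Qed.

Lemma cmul0r a : a ** 0 = 0.
Proof. by apply: (@addrI _ (a ** 0)); rewrite -cmulDr !addr0. Qed.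

Lemma cmulZl k a b : (k *: a) ** b = k *: (a ** b).
Proof. by have := cmul_linearl k a 0 b; rewrite cmul0l !addr0. Qed.

Lemma cmulZr k a b : a ** (k *: b) = k *: (a ** b).
Proof. by have := cmul_linearr k b 0 a; rewrite cmul0r !addr0. Qed.

Lemma cmulNl a b : (- a) ** b = - (a ** b).
Proof. by rewrite -scaleN1r cmulZl scaleN1r. Qed.

Lemma cmulNr a b : a ** (- b) = - (a ** b).
Proof. by rewrite -scaleN1r cmulZr scaleN1r. Qed.

Lemma cmulBl a b c : (a - b) ** c = a ** c - b ** c.
Proof. by rewrite cmulDl cmulNl. Qed.

Lemma cmulBr a b c : a ** (b - c) = a ** b - a ** c.
Proof. by rewrite cmulDr cmulNr. Qed.

Lemma starD a b : (a + b)^`* = a^`* + b^`*.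
Proof. by have := star_antilinear 1 a b; rewrite rmorph1 !scale1r. Qed.

Lemma star0 : (0 : A)^`* = 0.
Proof. by apply: (@addrI _ ((0 : A)^`*)); rewrite -starD !addr0. Qed.

Lemma starZ k a : (k *: a)^`* = k^* *: a^`*.
Proof. by have := star_antilinear k a 0; rewrite star0 !addr0. Qed.

Lemma starZ_real (r : R) a : (r%:C%C *: a)^`* = r%:C%C *: a^`*.
Proof. by rewrite starZ conj_Creal // complex_real. Qed.

Lemma half_scaleD a : (2^-1 : R)%:C%C *: a + (2^-1 : R)%:C%C *: a = a.
Proof.
by rewrite -scalerDl -rmorphD /= (_ : 2^-1 + 2^-1 = 1) ?scale1r //; field.
Qed.

Lemma starN a : (- a)^`* = - a^`*.
Proof. by rewrite -scaleN1r starZ rmorphN rmorph1 scaleN1r. Qed.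

Lemma starB a b : (a - b)^`* = a^`* - b^`*.
Proof. by rewrite starD starN. Qed.

Lemma rnorm_cmul a b : rnorm (a ** b) <= rnorm a * rnorm b.
Proof. by rewrite -lecR rmorphM /= -!rnormE ler_norm_cmul. Qed.

Lemma rnorm_cstar a : rnorm (a^`* ** a) = rnorm a ^+ 2.
Proof. by apply: (@complexI R); rewrite rmorphXn /= -!rnormE cstar_identity. Qed.

(** The identity [rnorm_cstar] and submultiplicativity give
[rnorm a <= rnorm a^`*]; the involution turns this into an equality. *)
Lemma rnorm_star a : rnorm a^`* = rnorm a.
Proof.
have le_star b : rnorm b <= rnorm b^`*.
  have := rnorm_cmul b^`* b; rewrite rnorm_cstar expr2.
  have := rnorm_ge0 b; rewrite le_eqVlt => /orP[/eqP<- _|b0].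
    exact: rnorm_ge0.
  by rewrite ler_pM2r.
by apply/eqP; rewrite eq_le -{2}[a]starK !le_star.
Qed.

Lemma rnorm_sqr_selfadjoint a : a^`* = a -> rnorm (a ** a) = rnorm a ^+ 2.
Proof. by move=> sa; rewrite -{1}sa rnorm_cstar. Qed.

Lemma cvg_star (u : nat -> A) a :
  (u n @[n --> \oo] --> a)%classic -> ((u n)^`* @[n --> \oo] --> a^`*)%classic.
Proof.
move=> /cvg_rnorm ua; apply/cvg_rnorm; apply: cvg_trans ua.
by apply: near_eq_cvg; apply: nearW => n; rewrite -starB rnorm_star.
Qed.

Lemma cvg_cmul (u v : nat -> A) a b :
  (u n @[n --> \oo] --> a)%classic -> (v n @[n --> \oo] --> b)%classic ->
  (u n ** v n @[n --> \oo] --> a ** b)%classic.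
Proof.
move=> /cvg_rnorm ua /cvg_rnorm vb.
pose p n := rnorm (u n - a); pose q n := rnorm (v n - b).
apply: (rnorm_squeeze (e := fun n => p n * q n + p n * rnorm b + rnorm a * q n)).
  move=> n; have -> : u n ** v n - a ** b =
      (u n - a) ** (v n - b) + (u n - a) ** b + a ** (v n - b).
    by rewrite -cmulDr subrK cmulBl cmulBr addrA subrK.
  rewrite (le_trans (ler_rnormD _ _)) // lerD ?rnorm_cmul //.
  by rewrite (le_trans (ler_rnormD _ _)) // lerD ?rnorm_cmul.
rewrite -[X in (_ --> X)%classic](_ : 0 * 0 + 0 * rnorm b + rnorm a * 0 = 0).
  apply: cvgD; first apply: cvgD.
  - exact: cvgM.
  - exact: cvgMl.
  - exact: cvgMr.
by rewrite !mul0r mulr0 !addr0.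
Qed.

Lemma selfadjoint_cvg (u : nat -> A) a : (forall n, (u n)^`* = u n) ->
  (u n @[n --> \oo] --> a)%classic -> a^`* = a.
Proof.
move=> su ua; apply: (@cvg_unique _ (@norm_hausdorff _ A) (u @ \oo)%classic) => //.
by have := cvg_star ua; under eq_cvg do rewrite su.
Qed.

End CStarBasics.

(** * Fixed points by the method of majorants *)

Section Majorant.
Context {R : realType} {A : completeNormedModType R[i]}.

(** The scalar iterates of [phi] increase to a limit at most [T], and they
control the distances between the iterates of [F], which therefore form a
Cauchy sequence.  The Lipschitz constant [L] may reach one on the boundary of
the ball, where [F] is no contraction. *)
Lemma majorant_fixpoint (F : A -> A) (phi : R -> R) (L : R -> R -> R) (T : R) :
  0 <= T -> 0 <= phi 0 -> (forall t, 0 <= t <= T -> phi t <= T) ->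
  (forall s t, phi t - phi s = L s t * (t - s)) ->
  (forall s t, 0 <= s <= T -> 0 <= t <= T -> 0 <= L s t <= 1) ->
  rnorm (F 0) <= phi 0 ->
  (forall u v s t, 0 <= s <= T -> 0 <= t <= T -> rnorm u <= s -> rnorm v <= t ->
     rnorm (F v - F u) <= L s t * rnorm (v - u)) ->
  exists x, F x = x.
Proof.
move=> T0 phi0 phiT phiL L01 F0 FL.
pose u n := iter n F 0; pose t n := iter n phi 0.
have key n : [/\ 0 <= t n, t n <= t n.+1, t n.+1 <= T, rnorm (u n) <= t n &
    rnorm (u n.+1 - u n) <= t n.+1 - t n].
  elim: n => [|n [t_ge0 t_le tT un udist]].
    by rewrite /u /t /= rnorm0 !subr0 lexx phiT ?lexx.
  have un1 : rnorm (u n.+1) <= t n.+1.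
    rewrite -[u n.+1](subrK (u n)) (le_trans (ler_rnormD _ _)) //.
    by rewrite -[leRHS](subrK (t n)) lerD.
  have tn : 0 <= t n <= T by rewrite t_ge0 (le_trans t_le).
  have tn1 : 0 <= t n.+1 <= T by rewrite tT (le_trans t_ge0).
  have dist : rnorm (u n.+2 - u n.+1) <= t n.+2 - t n.+1.
    have /andP[L0 _] := L01 _ _ tn tn1.
    by rewrite (le_trans (FL _ _ _ _ tn tn1 _ _)) // phiL ler_wpM2l.
  have tt : t n.+1 <= t n.+2 by rewrite -subr_ge0 (le_trans (rnorm_ge0 _) dist).
  by split=> //; [case/andP: tn1 | exact: phiT].
have dist n m : rnorm (u (n + m)%N - u n) <= t (n + m)%N - t n.
  elim: m => [|m IHm]; first by rewrite addn0 !subrr rnorm0.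
  rewrite addnS -[u _ - _](subrKA (u (n + m)%N)).
  rewrite (le_trans (ler_rnormD _ _)) //.
  rewrite -[leRHS](subrKA (t (n + m)%N)) lerD //.
  by have [] := key (n + m)%N.
have t_nd : nondecreasing_seq t.
  by apply/nondecreasing_seqP => n; have [] := key n.
have t_bnd : has_ubound (range t).
  by exists T => _ [n _ <-]; have [_ tn tT _ _] := key n; exact: le_trans tT.
have /cvg_ex[s ts] := nondecreasing_is_cvgn t_nd t_bnd.
have t_lims n : t n <= s.
  by rewrite -(cvg_lim _ ts) //; apply: nondecreasing_cvgn_le; last exact: cvgP ts.
have /cvg_ex[x ux] : cvgn u.
  apply: (rnorm_cauchy_cvg (e := fun n => s - t n)).
    by move=> n m; rewrite (le_trans (dist n m)) // lerB.
  by rewrite -[X in (_ --> X)%classic](subrr s); apply: cvgB => //; exact: cvg_cst.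
have uT n : rnorm (u n) <= T.
  by have [_ tn tT un _] := key n; rewrite (le_trans un) // (le_trans tn).
have xT : rnorm x <= T by exact: cvg_rnorm_le ux uT.
have TT : 0 <= T <= T by rewrite T0 lexx.
exists x.
apply: (@cvg_unique _ (@norm_hausdorff _ A) ((fun n => u n.+1) @ \oo)%classic).
  apply: (rnorm_squeeze (e := fun n => rnorm (u n - x))).
    move=> n; have /andP[_ L1] := L01 _ _ TT TT.
    by rewrite (le_trans (FL _ _ _ _ TT TT _ _)) // ler_piMl ?rnorm_ge0.
  exact/cvg_rnorm.
by have := ux; rewrite -(cvg_shiftS u).
Qed.

End Majorant.

(** * The unitization and polynomial functions of an element *)

Definition unitization {R : realType} (A : cstarAlgType R) := (A * R[i])%type.

Section Unitization.
Context {R : realType} {A : cstarAlgType R}.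
Local Notation U := (unitization A).

HB.instance Definition _ := GRing.Lmodule.copy U (A * R[i]^o)%type.

Fact unitization_mulA : associative (unitization_mul : U -> U -> U).
Proof.
move=> [a k] [b l] [c m]; rewrite /unitization_mul /=; congr pair; last exact: mulrA.
rewrite !cmulDl !cmulDr !cmulZl !cmulZr !scalerDr cmulA !scalerA.
rewrite [m * k]mulrC [m * l]mulrC -!addrA; congr (_ + _).
by rewrite [RHS]addrCA; congr (_ + _); rewrite addrCA; congr (_ + _); exact: addrCA.
Qed.

Fact unitization_mul1l : left_id unitization_one (unitization_mul : U -> U -> U).
Proof.
by case=> a k; rewrite /unitization_mul /= cmul0l scale1r scaler0 add0r addr0 mul1r.
Qed.

Fact unitization_mul1r : right_id unitization_one (unitization_mul : U -> U -> U).
Proof.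
by case=> a k; rewrite /unitization_mul /= cmul0r scale1r scaler0 !add0r mulr1.
Qed.

Fact unitization_mulDl : left_distributive (unitization_mul : U -> U -> U) +%R.
Proof.
move=> [a k] [b l] [c m]; rewrite /unitization_mul /=; congr pair; last exact: mulrDl.
by rewrite /= cmulDl scalerDl scalerDr [RHS]addrACA; congr (_ + _); exact: addrACA.
Qed.

Fact unitization_mulDr : right_distributive (unitization_mul : U -> U -> U) +%R.
Proof.
move=> [a k] [b l] [c m]; rewrite /unitization_mul /=; congr pair; last exact: mulrDr.
by rewrite /= cmulDr scalerDl scalerDr [RHS]addrACA; congr (_ + _); exact: addrACA.
Qed.

Fact unitization_one_neq0 : unitization_one != 0 :> U.
Proof. by apply/eqP => -[/eqP]; rewrite oner_eq0. Qed.

HB.instance Definition _ := GRing.Zmodule_isNzRing.Build U unitization_mulA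
  unitization_mul1l unitization_mul1r unitization_mulDl unitization_mulDr
  unitization_one_neq0.

Fact unitization_scaleAl (k : R[i]) (u v : U) : k *: (u * v) = (k *: u) * v.
Proof.
case: u v => [a l] [b m]; congr pair; last exact: mulrA.
by rewrite /= !scalerDr cmulZl !scalerA [k * m]mulrC.
Qed.

HB.instance Definition _ := GRing.Lmodule_isLalgebra.Build R[i] U unitization_scaleAl.

Fact unitization_scaleAr (k : R[i]) (u v : U) : k *: (u * v) = u * (k *: v).
Proof.
case: u v => [a l] [b m]; congr pair; last exact: mulrCA.
by rewrite /= !scalerDr cmulZr !scalerA [k * l]mulrC.
Qed.

HB.instance Definition _ := GRing.Lalgebra_isAlgebra.Build R[i] U unitization_scaleAr.

Implicit Types (a b : A) (u v : U) (p q : {poly R}).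

Lemma unitization_mul_fst u v :
  (u * v).1 = u.1 ** v.1 + u.2 *: v.1 + v.2 *: u.1.
Proof. by []. Qed.

Lemma unitization_invertibleP u :
  unitization_invertible u <-> exists v, u * v = 1 /\ v * u = 1.
Proof. by []. Qed.

Lemma unitization_invertibleM u v :
  unitization_invertible u -> unitization_invertible v ->
  unitization_invertible (u * v).
Proof.
move=> /unitization_invertibleP[u' [uu' u'u]] /unitization_invertibleP[v' [vv' v'v]].
apply/unitization_invertibleP; exists (v' * u'); split.
  by rewrite mulrA -[u * v * _]mulrA vv' mulr1.
by rewrite mulrA -[_ * u' * u]mulrA u'u mulr1.
Qed.

(** If [w] is inverse to [u * v = v * u] then [v * w] is a right inverse and
[w * v] a left inverse of [u]. *)
Lemma unitization_invertible_factor u v :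
  u * v = v * u -> unitization_invertible (u * v) -> unitization_invertible u.
Proof.
move=> uv /unitization_invertibleP[w [uvw wuv]].
apply/unitization_invertibleP; exists (v * w); split; first by rewrite mulrA.
have wvu : w * v * u = 1 by rewrite -mulrA -uv.
rewrite -[LHS]mul1r -{1}wvu !mulrA -[w * v * u * v]mulrA -[w * v * (u * v) * w]mulrA.
by rewrite uvw mulr1.
Qed.

Lemma unitization_invertibleZ (k : R[i]) u : k != 0 ->
  unitization_invertible u -> unitization_invertible (k *: u).
Proof.
move=> k0 /unitization_invertibleP[v [uv vu]].
apply/unitization_invertibleP; exists (k^-1 *: v).
by rewrite -!scalerAl -!scalerAr !scalerA divff // mulVf // !scale1r.
Qed.

Definition to_unitization (a : A) : U := (a, 0).

(** The value of a real polynomial at [a], in the unitization because of its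
constant term.  It is locked to keep unification from unfolding Horner schemes. *)
Definition peval (a : A) : {poly R} -> U :=
  locked (horner_alg (to_unitization a) \o map_poly (real_complex R)).

(** The component of [p(a)] in the algebra itself, which is all of [p(a)] when
[p] has no constant term. *)
Definition acalc (p : {poly R}) (a : A) : A := (peval a p).1.

Lemma pevalX a : peval a 'X = to_unitization a.
Proof. by rewrite /peval -lock /= map_polyX horner_algX. Qed.

Lemma pevalC a (c : R) : peval a c%:P = (0, c%:C%C).
Proof.
rewrite /peval -lock /= map_polyC horner_algC; congr pair; first exact: scaler0.
exact: mulr1.
Qed.

Lemma peval0 a : peval a 0 = 0.
Proof. rewrite /peval -lock; exact: rmorph0. Qed.

Lemma peval1 a : peval a 1 = 1.
Proof. rewrite /peval -lock; exact: rmorph1. Qed.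

Lemma pevalM a p q : peval a (p * q) = peval a p * peval a q.
Proof. rewrite /peval -lock; exact: rmorphM. Qed.

Lemma pevalB a p q : peval a (p - q) = peval a p - peval a q.
Proof. rewrite /peval -lock; exact: rmorphB. Qed.

Lemma pevalD a p q : peval a (p + q) = peval a p + peval a q.
Proof. rewrite /peval -lock; exact: rmorphD. Qed.

Lemma peval_MXaddC a p (c : R) :
  peval a (p * 'X + c%:P) = peval a p * to_unitization a + (0, c%:C%C).
Proof. by rewrite pevalD pevalM pevalX pevalC. Qed.

Lemma peval2 a p : (peval a p).2 = (p.[0])%:C%C.
Proof.
elim/poly_ind: p => [|p c _]; first by rewrite peval0 horner0.
by rewrite peval_MXaddC [LHS]/= mulr0 add0r !hornerE.
Qed.

Lemma pevalE a p : p.[0] = 0 -> peval a p = to_unitization (acalc p a).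
Proof. by move=> p0; rewrite [LHS]surjective_pairing peval2 p0. Qed.

Lemma acalcX a : acalc 'X a = a.
Proof. by rewrite /acalc pevalX. Qed.

Lemma acalcD p q a : acalc (p + q) a = acalc p a + acalc q a.
Proof. by rewrite /acalc pevalD. Qed.

Lemma acalcB p q a : acalc (p - q) a = acalc p a - acalc q a.
Proof. by rewrite /acalc pevalB. Qed.

Lemma acalcM p q a : p.[0] = 0 -> q.[0] = 0 ->
  acalc (p * q) a = acalc p a ** acalc q a.
Proof.
move=> p0 q0; rewrite /acalc pevalM unitization_mul_fst !peval2 p0 q0.
by rewrite !scale0r !addr0.
Qed.

Lemma acalcZ (c : R) p a : acalc (c *: p) a = c%:C%C *: acalc p a.
Proof.
rewrite /acalc -mul_polyC pevalM unitization_mul_fst pevalC.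
by rewrite cmul0l scaler0 addr0 add0r.
Qed.

Lemma acalc_comm p q a : acalc p a ** acalc q a = acalc q a ** acalc p a.
Proof.
have /(congr1 (fun u : U => u.1)) : peval a p * peval a q = peval a q * peval a p.
  by rewrite -!pevalM mulrC.
rewrite !unitization_mul_fst -!addrA.
by rewrite [_ *: (peval a q).1 + _]addrC => /addIr.
Qed.

Lemma acalc_MXaddC p (c : R) a :
  acalc (p * 'X + c%:P) a = acalc p a ** a + p.[0]%:C%C *: a.
Proof. by rewrite /acalc peval_MXaddC [LHS]/= scale0r !addr0 peval2. Qed.

Lemma acalc_star p a : a^`* = a -> (acalc p a)^`* = acalc p a.
Proof.
move=> sa; elim/poly_ind: p => [|p c IHp]; first by rewrite /acalc peval0 star0.
rewrite acalc_MXaddC starD star_cmul starZ_real sa IHp; congr (_ + _).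
by rewrite -[X in X ** _](acalcX a) acalc_comm acalcX.
Qed.

End Unitization.

(** * The norm of a self-adjoint element is attained on its spectrum *)

Section NormAttained.
Context {R : realType} {A : cstarAlgType R}.
Implicit Types (a b h : A) (p q u : {poly R}).
Local Notation U := (unitization A).

(** With [w = a + i b] commutation gives [w^* w = a^2 + b^2], while
[2 a = w^* + w] and both summands have the norm of [w]. *)
Lemma rnorm_le_selfadjoint_sum a b : a^`* = a -> b^`* = b -> a ** b = b ** a ->
  rnorm a ^+ 2 <= rnorm (a ** a + b ** b).
Proof.
move=> sa sb ab; pose w := a + 'i%C *: b.
have starw : w^`* = a - 'i%C *: b.
  rewrite starD starZ sa sb -scaleNr; congr (_ + _ *: _); apply/eqP.
  by rewrite eq_complex /= oppr0 !eqxx.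
have <- : w^`* ** w = a ** a + b ** b.
  rewrite starw /w cmulBl !cmulDr !cmulZl !cmulZr ab scalerA -expr2 sqr_i.
  by rewrite scaleN1r opprD opprK addrA addrK.
rewrite rnorm_cstar lerXn2r ?nnegrE ?rnorm_ge0 //.
have : rnorm ((2%:R : R)%:C%C *: a) <= rnorm w^`* + rnorm w.
  rewrite -[X in rnorm X <= _](_ : w^`* + w = _); first exact: ler_rnormD.
  by rewrite starw addrACA addNr addr0 rmorph_nat scaler_nat.
by rewrite rnormZ ?ler0n // rnorm_star; lra.
Qed.

(** A noncommutative substitute for [2 t <= 1 + t ^+ 2]: it follows from
[(1 + t ^+ 2) ^+ 2 = (2 t) ^+ 2 + (1 - t ^+ 2) ^+ 2] by dropping the second
square. *)
Lemma rnorm_acalc_mul1Dsqr h u q : h^`* = h -> u.[0] = 0 -> q.[0] = 0 ->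
  2 * rnorm (acalc (u * q) h) <= rnorm (acalc (u * (1 + q ^+ 2)) h).
Proof.
move=> sh u0 q0; rewrite -(@ler_pXn2r _ 2) ?nnegrE ?mulr_ge0 ?rnorm_ge0 //.
rewrite exprMn -!rnorm_sqr_selfadjoint ?acalc_star //.
have uq0 p : (u * p).[0] = 0 by rewrite hornerM u0 mul0r.
rewrite -!acalcM //.
have -> : u * (1 + q ^+ 2) * (u * (1 + q ^+ 2)) =
    (2 *: (u * q)) * (2 *: (u * q)) + (u * (1 - q ^+ 2)) * (u * (1 - q ^+ 2)).
  by rewrite -mul_polyC rmorph_nat; ring.
have uq20 : (2 *: (u * q)).[0] = 0 by rewrite hornerZ uq0 mulr0.
rewrite acalcD (acalcM _ uq20 uq20) !(acalcM _ (uq0 _) (uq0 _)).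
rewrite (le_trans _ (rnorm_le_selfadjoint_sum _ _ _)) ?acalc_star //.
  by rewrite acalcZ rnormZ // exprMn rnorm_sqr_selfadjoint ?acalc_star.
exact: acalc_comm.
Qed.

(** The geometric sum of the [2 ^ j] first powers of ['X ^+ 2].  The product form
is the one to which the previous lemma applies factor by factor. *)
Fixpoint geom_prod (j : nat) : {poly R} :=
  if j is j'.+1 then geom_prod j' * (1 + ('X ^+ (2 ^ j')) ^+ 2) else 1.

Lemma geom_prodE j : (1 - 'X ^+ 2) * geom_prod j = 1 - ('X ^+ (2 ^ j)) ^+ 2.
Proof.
elim: j => [|j IHj] /=; first by rewrite mulr1.
rewrite mulrA IHj [in RHS]expnS mulnC exprM; ring.
Qed.

(** The geometric sum is as large as if its [2 ^ j] terms all had the size of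
their geometric mean. *)
Lemma rnorm_geom_prod h j u : h^`* = h -> u.[0] = 0 ->
  2 ^+ j * rnorm (acalc (u * 'X ^+ (2 ^ j).-1) h) <=
  rnorm (acalc (u * geom_prod j) h).
Proof.
move=> sh; elim: j u => [|j IHj] u u0 /=; first by rewrite expr0 mul1r.
have Xj0 : ('X ^+ (2 ^ j) : {poly R}).[0] = 0.
  by rewrite hornerXn expr0n expn_eq0.
rewrite mulrA (le_trans _ (rnorm_acalc_mul1Dsqr sh _ Xj0)) //; last first.
  by rewrite hornerM u0 mul0r.
rewrite exprS -mulrA ler_pM2l // -mulrA [geom_prod j * _]mulrC mulrA.
rewrite (le_trans _ (IHj _ _)) ?hornerM ?u0 ?mul0r //.
rewrite -mulrA -exprD; suff -> : (2 ^ j.+1).-1 = (2 ^ j + (2 ^ j).-1)%N by [].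
by rewrite -!subn1 addnBA ?expn_gt0 // addnn -mul2n -expnS.
Qed.

Lemma rnorm_acalcXn h j : h^`* = h -> rnorm h = 1 ->
  rnorm (acalc ('X ^+ (2 ^ j)) h) = 1.
Proof.
move=> sh h1; elim: j => [|j IHj]; first by rewrite expr1 acalcX.
rewrite expnS mulnC exprM expr2 acalcM ?hornerXn ?expr0n ?expn_eq0 //.
by rewrite rnorm_sqr_selfadjoint ?acalc_star // IHj expr1n.
Qed.

(** One of the points [1] and [-1] is in the spectrum of [h]: the geometric sums
[h + h ^+ 3 + h ^+ 5 + ...] have unbounded norms, but multiplied by [1 - h ^+ 2]
they telescope to differences of norm at most [2].  This replaces the spectral
radius formula. *)
Lemma not_invertible_1Bsqr h : h^`* = h -> rnorm h = 1 ->
  ~ unitization_invertible (1 - to_unitization h ^+ 2).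
Proof.
move=> sh h1 /unitization_invertibleP[v [_ vh]].
have pevalE1 : peval h (1 - 'X ^+ 2) = 1 - to_unitization h ^+ 2.
  by rewrite pevalB peval1 expr2 pevalM pevalX.
have bound j : 2 ^+ j <= (rnorm v.1 + complex.Re `|v.2|) * 2.
  pose y := acalc ('X - 'X * ('X ^+ (2 ^ j)) ^+ 2 : {poly R}) h.
  have y2 : rnorm y <= 2.
    rewrite /y acalcB acalcX (le_trans (ler_rnormB _ _)) // h1 lerD //.
    rewrite acalcM ?hornerX // -?exprM -?expnSr; last first.
      by rewrite hornerXn expr0n expn_eq0.
    by rewrite (le_trans (rnorm_cmul _ _)) // acalcX h1 mul1r rnorm_acalcXn.
  have wE : acalc ('X * geom_prod j) h = v.1 ** y + v.2 *: y.
    have -> : v.1 ** y + v.2 *: y = (v * to_unitization y).1.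
      by rewrite unitization_mul_fst scale0r addr0.
    have y0 : ('X - 'X * ('X ^+ (2 ^ j)) ^+ 2 : {poly R}).[0] = 0.
      by rewrite hornerD hornerN hornerM hornerX mul0r subrr.
    rewrite -pevalE //.
    have -> : 'X - 'X * ('X ^+ (2 ^ j)) ^+ 2 =
        (1 - 'X ^+ 2) * ('X * geom_prod j) :> {poly R}.
      by rewrite [RHS]mulrCA geom_prodE mulrBr mulr1.
    by rewrite pevalM mulrA pevalE1 vh mul1r.
  have := rnorm_geom_prod j sh (hornerX 0).
  rewrite -exprS prednK ?expn_gt0 // rnorm_acalcXn // mulr1 => /le_trans; apply.
  rewrite wE (le_trans (ler_rnormD _ _)) // mulrDl rnormZ_complex lerD //.
    by rewrite (le_trans (rnorm_cmul _ _)) // ler_wpM2l ?rnorm_ge0.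
  by rewrite ler_wpM2l // Re_norm_ge0.
have := bound (Num.bound ((rnorm v.1 + complex.Re `|v.2|) * 2)).
by rewrite leNgt upper_nthrootP.
Qed.

End NormAttained.

(** * Spectrum and functional calculus of positive elements *)

Section Spectrum.
Context {R : realType} {A : cstarAlgType R}.
Implicit Types (a b : A) (p q : {poly R}) (z : R[i]).
Local Notation U := (unitization A).

Lemma to_unitizationD a b :
  to_unitization (a + b) = to_unitization a + to_unitization b.
Proof. by congr pair; rewrite addr0. Qed.

Lemma to_unitizationM a b :
  to_unitization (a ** b) = to_unitization a * to_unitization b.
Proof.
by congr pair; rewrite /= ?scale0r ?addr0 // mulr0.
Qed.

Lemma spectrumE a z :
  spectrum a z <-> ~ unitization_invertible (z *: 1 - to_unitization a : U).
Proof.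
rewrite /spectrum /=.
suff -> : (- a, z) = z *: 1 - to_unitization a :> U by [].
by congr pair; rewrite /= ?scaler0 ?add0r ?subr0 ?oppr0 // -[LHS]mulr1.
Qed.

(** The Neumann series [a + a ^+ 2 + ...] is obtained as the fixed point of
[y = a + a ** y]; the mirror equation gives a left inverse, and the two inverses
agree. *)
Lemma invertible_1B a : rnorm a < 1 ->
  unitization_invertible (1 - to_unitization a : U).
Proof.
move=> a1; pose r := rnorm a; pose T := r / (1 - r).
have r1 : 0 < 1 - r by rewrite subr_gt0.
have r0 : 0 <= r by exact: rnorm_ge0.
have T0 : 0 <= T by rewrite divr_ge0 // ltW.
have TE : r + r * T = T by rewrite /T; field; rewrite lt0r_neq0.
have solve (F : A -> A) : rnorm (F 0) <= r ->
    (forall u v, rnorm (F v - F u) <= r * rnorm (v - u)) -> exists y, F y = y.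
  move=> F0 FL.
  apply: (@majorant_fixpoint _ _ F (fun t => r + r * t) (fun _ _ => r) T) => //.
  - by rewrite mulr0 addr0.
  - by move=> t /andP[_ tT]; rewrite -[leRHS]TE lerD2l ler_wpM2l.
  - by move=> s t; ring.
  - by move=> _ _ _ _; rewrite r0 ltW.
  - by rewrite mulr0 addr0.
have [||y yE] := solve (fun y => a + a ** y).
- by rewrite cmul0r addr0.
- by move=> u v; rewrite opprD addrACA subrr add0r -cmulBr rnorm_cmul.
have [||w wE] := solve (fun y => a + y ** a).
- by rewrite cmul0l addr0.
- by move=> u v; rewrite opprD addrACA subrr add0r -cmulBl mulrC rnorm_cmul.
have right_inv : (1 - to_unitization a) * (1 + to_unitization y) = 1.
  rewrite mulrBl mul1r mulrDr mulr1 -to_unitizationM -to_unitizationD.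
  by rewrite [a + _]yE addrK.
have left_inv : (1 + to_unitization w) * (1 - to_unitization a) = 1.
  rewrite mulrBr mulr1 mulrDl mul1r -to_unitizationM -to_unitizationD.
  by rewrite [a + _]wE addrK.
apply/unitization_invertibleP; exists (1 + to_unitization y); split=> //.
rewrite -[X in X * _]mul1r -{1}left_inv -[(_ * _) * (1 + to_unitization y)]mulrA.
by rewrite right_inv mulr1.
Qed.

Lemma invertible_scalarB a z : rnorm a < complex.Re `|z| ->
  unitization_invertible (z *: 1 - to_unitization a : U).
Proof.
move=> az; have z0 : z != 0.
  by apply: contraTneq az => ->; rewrite normr0 -leNgt rnorm_ge0.
have -> : z *: 1 - to_unitization a =
    z *: (1 - to_unitization (z^-1 *: a)) :> U.
  rewrite scalerBr; congr (_ - _); congr pair => /=; last by rewrite scaler0.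
  by rewrite scalerA divff // scale1r.
apply: unitization_invertibleZ => //; apply: invertible_1B.
have Rez : 0 < complex.Re `|z| by exact: le_lt_trans (rnorm_ge0 a) az.
have -> : rnorm (z^-1 *: a) = (complex.Re `|z|)^-1 * rnorm a.
  apply: (@complexI R); rewrite -rnormE normrZ normfV rmorphM /= -rnormE; congr (_ * _).
  by rewrite -{1}(RRe_real (normr_real z)) -fmorphV.
by rewrite mulrC ltr_pdivrMr // mul1r.
Qed.

Lemma spectrum_le_rnorm a z : spectrum a z -> complex.Re `|z| <= rnorm a.
Proof. by move/spectrumE => za; rewrite leNgt; apply/negP => /invertible_scalarB. Qed.

(** Over the complex numbers [p] is a product of linear factors, one of which
is not invertible at [a]. *)
Lemma not_invertible_peval a p : p != 0 ->
  ~ unitization_invertible (peval a p : U) ->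
  exists2 z, spectrum a z & root (map_poly (real_complex R) p) z.
Proof.
move=> p0 np; set P := map_poly _ _.
have P0 : P != 0 by rewrite map_poly_eq0.
have [r Pr] := closed_field_poly_normal P.
apply: contra_notP np => nosp.
rewrite /peval -lock /= -/P Pr linearZ /=.
have rP z : z \in r -> root P z.
  by move=> zr; rewrite Pr rootZ ?lead_coef_eq0 // root_prod_XsubC.
rewrite -scalerAl mul1r; apply: unitization_invertibleZ; first by rewrite lead_coef_eq0.
elim: r {Pr} rP => [_|z r IHr rP].
  rewrite big_nil rmorph1; apply/unitization_invertibleP.
  by exists 1; rewrite mulr1.
rewrite big_cons rmorphM; apply: unitization_invertibleM; last first.
  by apply: IHr => w wr; apply: rP; rewrite inE wr orbT.
rewrite rmorphB /= horner_algX horner_algC -opprB -scaleN1r.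
apply: unitization_invertibleZ; first by rewrite oppr_eq0 oner_eq0.
apply: contrapT => nz; apply: nosp; exists z; first exact/spectrumE.
by apply: rP; rewrite inE eqxx.
Qed.

Lemma complex_ge0P z : 0 <= z -> exists2 t : R, 0 <= t & z = t%:C%C.
Proof.
move=> z0; exists (complex.Re z).
  by move: z0; rewrite lecE => /andP[].
by rewrite RRe_real // realE z0.
Qed.

(** The norm of [q(a)] is at most the supremum of [`|q|] on the spectrum, hence on
the unit interval.  Indeed, if [rho] is this norm, then [1 - (q / rho) ^+ 2] is
not invertible at [a], so it vanishes at a point of the spectrum. *)
Lemma rnorm_acalc_le a q (M : R) : positive a -> rnorm a <= 1 -> q.[0] = 0 ->
  (forall t, 0 <= t <= 1 -> `|q.[t]| <= M) -> rnorm (acalc q a) <= M.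
Proof.
move=> [sa pa] a1 q0 qM; rewrite leNgt; apply/negP => Mq.
pose rho := rnorm (acalc q a).
have M0 : 0 <= M by rewrite (le_trans (normr_ge0 _) (qM 0 _)) // lexx ler01.
have rho0 : 0 < rho by exact: le_lt_trans Mq.
pose p := rho^-1 *: q.
have p0 : p.[0] = 0 by rewrite hornerZ q0 mulr0.
have h1 : rnorm (acalc p a) = 1.
  by rewrite acalcZ rnormZ ?invr_ge0 ?rnorm_ge0 // mulVf // lt0r_neq0.
have [||z /[dup] za /pa z0] := @not_invertible_peval a (1 - p ^+ 2).
- apply: contraTneq (oner_neq0 R) => /(congr1 (fun u : {poly R} => u.[0])).
  rewrite hornerD hornerN horner_exp p0 expr0n subr0 hornerC hornerC => ->.
  by rewrite eqxx.
- rewrite pevalB peval1 expr2 pevalM pevalE // -expr2.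
  by apply: not_invertible_1Bsqr => //; exact: acalc_star.
have [t t0 zE] := complex_ge0P z0.
have t1 : t <= 1.
  have := spectrum_le_rnorm za; rewrite zE ger0_norm ?lecR //= => /le_trans; exact.
rewrite zE /root horner_map /= fmorph_eq0 hornerD hornerN horner_exp hornerC hornerZ.
rewrite subr_eq0 eq_sym exprMn exprVn => /eqP qt.
have : q.[t] ^+ 2 = rho ^+ 2.
  by rewrite -[RHS]mulr1 -qt mulrA divff ?mul1r // expf_neq0 // lt0r_neq0.
move/eqP; rewrite eqf_sqr => /orP[] /eqP qE.
  by have := qM t; rewrite t0 t1 qE gtr0_norm // leNgt Mq => /(_ isT).
by have := qM t; rewrite t0 t1 qE normrN gtr0_norm // leNgt Mq => /(_ isT).
Qed.

Lemma acalc_comp p q a : q.[0] = 0 -> acalc (p \Po q) a = acalc p (acalc q a).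
Proof.
move=> q0; elim/poly_ind: p => [|p c IHp].
  by rewrite comp_poly0 /acalc !peval0.
rewrite comp_polyD comp_polyM comp_polyX comp_polyC acalc_MXaddC -IHp acalcD.
rewrite [acalc c%:P a]/acalc pevalC addr0 /acalc pevalM unitization_mul_fst !peval2.
by rewrite horner_comp q0 scale0r addr0.
Qed.

Lemma cvg_acalc p (u : nat -> A) a : (u n @[n --> \oo] --> a)%classic ->
  (acalc p (u n) @[n --> \oo] --> acalc p a)%classic.
Proof.
move=> ua; elim/poly_ind: p => [|p c IHp].
  rewrite /acalc; under eq_cvg do rewrite peval0; rewrite peval0.
  exact: cvg_cst.
under eq_cvg do rewrite acalc_MXaddC; rewrite acalc_MXaddC.
by apply: cvgD; [exact: cvg_cmul | exact: cvgZr].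
Qed.

(** * Square roots of positive elements *)

(** The classical polynomial approximations of the square root on the unit
interval; they have no constant term, so they can be evaluated in an algebra
without unit. *)
Fixpoint sqrt_poly (n : nat) : {poly R} :=
  if n is n'.+1 then sqrt_poly n' + 2^-1 *: ('X - sqrt_poly n' ^+ 2) else 0.

Lemma sqrt_poly_at0 n : (sqrt_poly n).[0] = 0.
Proof.
elim: n => [|n IHn] /=; first by rewrite hornerC.
rewrite hornerD hornerZ hornerD hornerN hornerX horner_exp IHn expr0n /=.
by rewrite subr0 mulr0 addr0.
Qed.

(** The error [e n] at [s ^+ 2] satisfies [e n.+1 <= e n * (1 - s / 2)], and
[(1 - s / 2) * (2 + n.+1%:R * s) <= 2 + n%:R * s] keeps the bound. *)
Lemma sqrt_poly_itv n (s : R) : 0 <= s <= 1 ->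
  [/\ 0 <= (sqrt_poly n).[s ^+ 2], (sqrt_poly n).[s ^+ 2] <= s &
      (s - (sqrt_poly n).[s ^+ 2]) * (2 + n%:R * s) <= 2 * s].
Proof.
move=> /andP[s0 s1]; elim: n => [|n [P0 Ps Pd]] /=.
  by rewrite hornerC; split=> //; lra.
rewrite hornerD hornerZ hornerD hornerN hornerX horner_exp.
move: ((sqrt_poly n).[_]) P0 Ps Pd => x x0 xs.
rewrite -[n.+1%:R]natr1; move: (n%:R) (ler0n R n) => k k0 Pd.
have d0 : 0 <= (s - x) * (s + x) by rewrite mulr_ge0 ?subr_ge0 ?addr_ge0.
have d1 : 0 <= (s - x) * (2 - (s + x)) by rewrite mulr_ge0 ?subr_ge0 //; lra.
split; [nra|nra|].
have -> : s - (x + 2^-1 * (s ^+ 2 - x ^+ 2)) = (s - x) * (1 - (s + x) / 2) by field.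
have h1 : (1 - (s + x) / 2) <= 1 - s / 2 by lra.
have h2 : (s - x) * (1 - (s + x) / 2) <= (s - x) * (1 - s / 2).
  by rewrite ler_wpM2l // subr_ge0.
have h3 : 0 <= 2 + (k + 1) * s by nra.
apply: (le_trans (ler_wpM2r h3 h2)).
have h4 : (s - x) * (1 - s / 2) * (2 + (k + 1) * s) =
  (s - x) * (2 + k * s) - (s - x) * s ^+ 2 * (k + 1) / 2 by field.
have h5 : 0 <= (s - x) * s ^+ 2 * (k + 1) by rewrite !mulr_ge0 ?subr_ge0 // addr_ge0.
rewrite h4; lra.
Qed.

Lemma unit_itv_sqr (t : R) : 0 <= t <= 1 -> exists2 s, 0 <= s <= 1 & t = s ^+ 2.
Proof.
move=> /andP[t0 t1]; exists (Num.sqrt t); last by rewrite sqr_sqrtr.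
by rewrite sqrtr_ge0 -[leRHS]sqrtr1 ler_wsqrtr.
Qed.

Lemma sqrt_poly_dist n m (t : R) : 0 <= t <= 1 ->
  `|(sqrt_poly (n + m)%N - sqrt_poly n).[t]| <= 2 / n.+1%:R.
Proof.
move=> /unit_itv_sqr[s s01 ->].
have near k : (n <= k)%N -> s - (sqrt_poly k).[s ^+ 2] <= 2 / n.+1%:R.
  move=> nk; have [P0 Ps Pd] := sqrt_poly_itv k s01.
  rewrite ler_pdivlMr ?ltr0n //.
  rewrite (@le_trans _ _ ((s - (sqrt_poly k).[s ^+ 2]) * k.+1%:R)) //.
    by rewrite ler_wpM2l ?subr_ge0 // ler_nat.
  have /andP[s0 s1] := s01; move: s0; rewrite le_eqVlt => /orP[/eqP s0|s0].
    move: P0 Ps; rewrite -s0 => P0 Ps.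
    by rewrite (_ : _ - _ = 0) ?mul0r //; apply/eqP; rewrite subr_eq0 eq_le Ps P0.
  rewrite -(ler_pM2r s0) (le_trans _ Pd) // -mulrA ler_wpM2l ?subr_ge0 //.
  rewrite -natr1; lra.
rewrite hornerD hornerN ler_norml; move: (2 / _) near => e near.
have [_ P1 _] := sqrt_poly_itv n s01; have := near n (leqnn n).
have [_ P2 _] := sqrt_poly_itv (n + m)%N s01; have := near (n + m)%N (leq_addr _ _).
by move=> d1 d2; apply/andP; split; lra.
Qed.

Lemma bernoulli_gt1 (k : R) : 0 < k -> exists N, 1 < k * (1 + k) ^+ N.
Proof.
move=> k0; have bern N : N%:R * k <= (1 + k) ^+ N.
  elim: N => [|N IHN]; first by rewrite mul0r.
  rewrite exprS -natr1; have : 1 <= (1 + k) ^+ N by rewrite exprn_ege1 // lerDl ltW.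
  move: IHN; set x := (1 + k) ^+ N; set n := N%:R; nra.
exists (Num.bound (k ^-2)); rewrite (lt_le_trans _ (ler_wpM2l (ltW k0) (bern _))) //.
rewrite mulrCA -expr2 -ltr_pdivrMr ?exprn_gt0 // div1r.
by rewrite archi_boundP // invr_ge0 exprn_ge0 // ltW.
Qed.

Lemma complex_sqr_ge0 z : 0 <= z * z -> z = (complex.Re z)%:C%C.
Proof.
case: z => x y; rewrite lecE /= => /andP[/eqP xy].
rewrite addrC [y * x]mulrC in xy; rewrite -expr2 -[y * y]expr2 => xy2.
suff -> : y = 0 by [].
have /eqP : x * y = 0 by lra.
rewrite mulf_eq0 => /orP[/eqP x0|/eqP//]; move: xy2.
rewrite x0 expr0n /= sub0r oppr_ge0 => y2; apply/eqP.
by rewrite -sqrf_eq0 eq_le y2 sqr_ge0.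
Qed.

Lemma spectrum_sqr b z : spectrum b z -> spectrum (b ** b) (z * z).
Proof.
move=> /spectrumE nzb; apply/spectrumE => inv_zb; apply: nzb.
(* The values [1] and [-1] of [s] give the two orders of the factors. *)
have factor (s : R[i]) :
    (z *: 1 - s *: to_unitization b) * (z *: 1 + s *: to_unitization b) =
    (z * z) *: 1 - (s * s) *: to_unitization (b ** b) :> U.
  rewrite mulrBl !mulrDr -!scalerAl -!scalerAr !mul1r !mulr1 !scalerA.
  by rewrite opprD addrA [z * s]mulrC addrK to_unitizationM.
have f1 := factor 1; have f2 := factor (-1).
rewrite !mulrNN !mulr1 !scaleN1r ?opprK !scale1r in f1 f2.
apply: (@unitization_invertible_factor _ _ _ (z *: 1 + to_unitization b)).
  by rewrite f1 f2.
by rewrite f1.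
Qed.

(** Bounded values on [b] of the polynomials ['X * (1 - 'X) ^+ N] exclude [- k]
from the spectrum, because their values at [- k] grow with [N]. *)
Lemma notin_spectrum_neg b (k : R) :
  (forall N, rnorm (acalc ('X * (1 - 'X) ^+ N) b) <= 1) -> 0 < k ->
  ~ spectrum b (- k%:C%C).
Proof.
move=> bN k0; have [N kN] := bernoulli_gt1 k0.
pose p : {poly R} := 'X * (1 - 'X) ^+ N; pose c := p.[- k].
have p0 : p.[0] = 0 by rewrite hornerM hornerX mul0r.
have c1 : 1 < `|c|.
  rewrite /c /p !hornerE opprK mulNr normrN ger0_norm //.
  by rewrite mulr_ge0 ?exprn_ge0 ?addr_ge0 // ltW.
have /factor_theorem[q pq] : root (p - c%:P) (- k).
  by rewrite /root hornerD hornerN hornerC subrr.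
move/spectrumE; apply; rewrite scaleNr.
have -> : - (k%:C%C *: 1) - to_unitization b = (-1) *: peval b ('X - (- k)%:P) :> U.
  rewrite scaleN1r pevalB pevalX pevalC opprB rmorphN; congr (_ - _); congr pair => /=.
    by rewrite scaler0 oppr0.
  by congr (- _); exact: mulr1.
apply: unitization_invertibleZ; first by rewrite oppr_eq0 oner_eq0.
apply: (@unitization_invertible_factor _ _ _ (peval b q)).
  by rewrite -!pevalM mulrC.
rewrite -pevalM mulrC -pq pevalB pevalC pevalE // -[X in unitization_invertible X]opprK.
rewrite -scaleN1r; apply: unitization_invertibleZ; first by rewrite oppr_eq0 oner_eq0.
rewrite opprB.
have -> : (0, c%:C%C) = c%:C%C *: 1 :> U.
  by congr pair; rewrite ?scaler0 //; exact/esym/mulr1.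
apply: invertible_scalarB; apply: le_lt_trans (bN N) _.
by rewrite normc_def /= expr0n addr0 sqrtr_sqr.
Qed.

(** The limit [b] of the approximations is positive: its spectrum is real because
the squares of its points are in the spectrum of [a], and it contains no negative
number because the polynomials ['X * (1 - 'X) ^+ N] map the unit interval to
itself. *)
Lemma exists_sqrt_le1 a : positive a -> rnorm a <= 1 ->
  exists b, positive b /\ b ** b = a.
Proof.
move=> pa a1; have [sa _] := pa.
pose u n := acalc (sqrt_poly n) a.
have P0 := sqrt_poly_at0.
have /cvg_ex[b ub] : cvgn u.
  apply: (rnorm_cauchy_cvg (e := fun n => 2 / n.+1%:R)).
    move=> n m; rewrite -acalcB; apply: rnorm_acalc_le => //.
      by rewrite hornerD hornerN !P0 subrr.
    by move=> t t01; exact: sqrt_poly_dist.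
  rewrite -[X in (_ --> X)%classic](mulr0 (2 : R)); apply: cvgMr.
  exact: cvg_harmonic.
have sb : b^`* = b by apply: selfadjoint_cvg ub => n; exact: acalc_star.
have b2 : b ** b = a.
  have lim1 : (u n ** u n + 2%:R%:C%C *: (u n.+1 - u n) @[n --> \oo] -->
               b ** b + 2%:R%:C%C *: (b - b))%classic.
    apply: cvgD; first exact: cvg_cmul.
    apply: cvgZr; apply: cvgB => //.
    by have := ub; rewrite -(cvg_shiftS u).
  have E n : u n ** u n + 2%:R%:C%C *: (u n.+1 - u n) = a.
    rewrite /u -acalcM // -acalcB -acalcZ -acalcD -[RHS]acalcX; congr acalc.
    rewrite /= [_ + _ - _]addrC addKr scalerA mulfV ?scale1r; last exact: lt0r_neq0.
    by rewrite -expr2 addrC subrK.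
  move: lim1; under eq_cvg do rewrite E.
  rewrite subrr scaler0 addr0 => lim1; apply/esym.
  apply: (@cvg_unique _ (@norm_hausdorff _ A) ((fun=> a) @ \oo)%classic) => //.
  exact: cvg_cst.
have bN N : rnorm (acalc ('X * (1 - 'X) ^+ N : {poly R}) b) <= 1.
  apply: (cvg_rnorm_le (cvg_acalc ub)) => n.
  rewrite -acalc_comp ?P0 //; apply: rnorm_acalc_le => //.
    by rewrite horner_comp P0 hornerM hornerX mul0r.
  move=> t /unit_itv_sqr[s s01 ->]; rewrite horner_comp.
  have [x0 xs _] := sqrt_poly_itv n s01; have /andP[_ s1] := s01.
  move: (sqrt_poly n).[_] x0 xs => x x0 xs.
  have x1 : x <= 1 by exact: le_trans xs s1.
  rewrite !hornerE ger0_norm ?mulr_ge0 ?exprn_ge0 ?subr_ge0 //.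
  by rewrite mulr_ile1 ?exprn_ge0 ?exprn_ile1 ?subr_ge0 // gerBl.
exists b; split=> //; split=> // z zb.
have z2 : 0 <= z * z by apply: pa.2; rewrite -b2; exact: spectrum_sqr.
have zE := complex_sqr_ge0 z2; rewrite zE lecR leNgt; apply/negP => z0.
have := @notin_spectrum_neg b (- complex.Re z) bN.
by rewrite oppr_gt0 rmorphN opprK /= -zE => /(_ z0); apply.
Qed.

Lemma positive_scale a (k : R) : 0 < k -> positive a -> positive (k%:C%C *: a).
Proof.
move=> k0 [sa pa]; split; first by rewrite starZ_real sa.
have kC0 : k%:C%C != 0 :> R[i] by rewrite fmorph_eq0 lt0r_neq0.
move=> z zka; rewrite -(mulVKf kC0 z) pmulr_rge0 ?ltcR //; apply: pa.
apply/spectrumE => inv; move/spectrumE: zka; apply.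
rewrite -[X in unitization_invertible X](_ :
  k%:C%C *: ((k%:C%C^-1 * z) *: 1 - to_unitization a) = _).
  exact: unitization_invertibleZ.
rewrite scalerBr scalerA mulVKf //; congr (_ - _); congr pair => /=; exact: scaler0.
Qed.

Lemma exists_sqrt a : positive a -> exists b, positive b /\ b ** b = a.
Proof.
move=> pa; have := rnorm_ge0 a; rewrite le_eqVlt => /orP[/eqP/esym/rnorm_eq0 a0|].
  by exists a; split=> //; rewrite a0 cmul0l.
set k := rnorm a => k0.
have [||b [pb b2]] := @exists_sqrt_le1 (k^-1%:C%C *: a).
- by apply: positive_scale; rewrite ?invr_gt0.
- by rewrite rnormZ ?invr_ge0 ?rnorm_ge0 // mulVf ?lt0r_neq0.
exists ((Num.sqrt k)%:C%C *: b); split.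
  by apply: positive_scale; rewrite ?sqrtr_gt0.
rewrite cmulZl cmulZr scalerA -rmorphM -expr2 sqr_sqrtr ?ltW //.
by rewrite b2 scalerA -rmorphM divff ?scale1r ?lt0r_neq0.
Qed.

Lemma cstar_sqrtK a : positive a -> cstar_sqr (cstar_sqrt a) = a.
Proof. by move=> /exists_sqrt/(xgetPex 0)[]. Qed.

End Spectrum.

(** * The Cauchy-Schwarz inequality in a Hilbert module *)

Section HilbertModule.
Context {R : realType} {A : cstarAlgType R} {X : hilbertModType A}.
Implicit Types (x y z : X) (a b c : A).

Lemma innerDr x y z : inner x (y + z) = inner x y + inner x z.
Proof. by have := inner_linearr 1 x y z; rewrite !scale1r. Qed.

Lemma inner0r x : inner x 0 = 0 :> A.
Proof. by apply: (@addrI _ (inner x 0)); rewrite -innerDr !addr0. Qed.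

Lemma innerZr (k : R[i]) x y : inner x (k *: y) = k *: inner x y.
Proof. by have := inner_linearr k x y 0; rewrite inner0r !addr0. Qed.

Lemma innerBr x y z : inner x (y - z) = inner x y - inner x z.
Proof. by rewrite innerDr -scaleN1r innerZr scaleN1r. Qed.

Lemma innerBl x y z : inner (x - y) z = inner x z - inner y z.
Proof. by rewrite -inner_star innerBr starB !inner_star. Qed.

Lemma inner_actl x y a : inner (act x a) y = a^`* ** inner x y.
Proof. by rewrite -inner_star inner_act star_cmul inner_star. Qed.

Lemma innerZ_real (k : R) x : 0 <= k ->
  inner ((Num.sqrt k)%:C%C *: x) ((Num.sqrt k)%:C%C *: x) = k%:C%C *: inner x x.
Proof.
move=> k0; rewrite innerZr -inner_star innerZr starZ_real inner_star scalerA.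
by rewrite -rmorphM -expr2 sqr_sqrtr.
Qed.

Lemma inner_sumr (I : Type) (r : seq I) (P : pred I) (F : I -> X) x :
  inner x (\sum_(i <- r | P i) F i) = \sum_(i <- r | P i) inner x (F i).
Proof. by elim/big_rec2: _ => [|i a y _ <-]; rewrite ?inner0r ?innerDr. Qed.

Lemma star_sum (I : Type) (r : seq I) (P : pred I) (F : I -> A) :
  (\sum_(i <- r | P i) F i)^`* = \sum_(i <- r | P i) (F i)^`*.
Proof. by elim/big_rec2: _ => [|i a y _ <-]; rewrite ?star0 ?starD. Qed.

Lemma inner_suml (I : Type) (r : seq I) (P : pred I) (F : I -> X) x :
  inner (\sum_(i <- r | P i) F i) x = \sum_(i <- r | P i) inner (F i) x.
Proof.
rewrite -inner_star inner_sumr star_sum.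
by apply: eq_bigr => i _; rewrite inner_star.
Qed.

Lemma rnorm_inner x : rnorm (inner x x) = rnorm x ^+ 2.
Proof.
by apply: (@complexI R); rewrite rmorphXn /= -!rnormE norm_inner sqrtCK.
Qed.

(** In the unitization [f = 2^-1 + q] solves [2 f = 1 + f c f], so
formally [f = (1 - (1 - c) ^ (1/2)) / c].  The iterated map is written with
[q^`*], which makes its fixed points self-adjoint.  Its majorant
[(2^-1 + t) ^+ 2 / 2] is tangent to the diagonal at the fixed point [2^-1]. *)
Lemma quadratic_fixpoint c : rnorm c <= 1 -> c^`* = c ->
  exists2 q, q^`* = q &
    q + q = (2^-1)%:C%C *: ((2^-1)%:C%C *: c + (c ** q + q ** c)) + q ** c ** q.
Proof.
move=> c1 sc; set h := (2^-1 : R)%:C%C.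
pose F q := h *: (h *: (h *: c + (c ** q + q^`* ** c)) + q^`* ** c ** q).
have h0 : 0 <= 2^-1 :> R by rewrite invr_ge0.
have [|||||||q Fq] := @majorant_fixpoint _ _ F (fun t => 2^-1 * (2^-1 + t) ^+ 2)
  (fun s t => 2^-1 * (1 + (s + t))) 2^-1.
- exact: h0.
- by rewrite mulr_ge0 ?sqr_ge0.
- by move=> t /andP[t0 t1]; nra.
- by move=> s t; field.
- by move=> s t /andP[s0 s1] /andP[t0 t1]; apply/andP; split; lra.
- rewrite /F star0 !(cmul0r, cmul0l) !addr0 !rnormZ //.
  by have := rnorm_ge0 c; nra.
- move=> u v s t /andP[s0 s1] /andP[t0 t1] us vt.
  have -> : F v - F u = h *: (h *: (c ** (v - u) + (v - u)^`* ** c) +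
                              (v^`* ** (c ** (v - u)) + (v - u)^`* ** (c ** u))).
    rewrite /F -scalerBr; congr (_ *: _).
    rewrite opprD addrACA -scalerBr; congr (_ *: _ + _).
      by rewrite opprD addrACA subrr add0r opprD addrACA -cmulBr -cmulBl -starB.
    by rewrite starB cmulBl !cmulA cmulBr addrA subrK.
  have cd w : rnorm (c ** w) <= rnorm w.
    by rewrite (le_trans (rnorm_cmul _ _)) // ler_piMl ?rnorm_ge0.
  have dc w : rnorm (w ** c) <= rnorm w.
    by rewrite (le_trans (rnorm_cmul _ _)) // ler_piMr ?rnorm_ge0.
  have dist0 := rnorm_ge0 (v - u).
  rewrite rnormZ // -mulrA ler_wpM2l // (le_trans (ler_rnormD _ _)) // mulrDl mul1r.
  rewrite lerD // ?rnormZ //.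
    rewrite (le_trans (ler_wpM2l h0 (ler_rnormD _ _))) //.
    by have := cd (v - u); have := dc (v - u)^`*; rewrite rnorm_star; lra.
  rewrite (le_trans (ler_rnormD _ _)) // addrC mulrDl lerD //.
    rewrite (le_trans (rnorm_cmul _ _)) // rnorm_star mulrC ler_wpM2r //.
    exact: le_trans (cd _) us.
  rewrite (le_trans (rnorm_cmul _ _)) // rnorm_star.
  by rewrite ler_pM ?rnorm_ge0.
have sq : q^`* = q.
  rewrite -Fq /F !(starZ_real, starD, star_cmul, starK) sc !cmulA.
  by rewrite [q^`* ** c + _]addrC.
by exists q => //; rewrite -{1 2}Fq /F sq half_scaleD.
Qed.

(** With [f] as above and [b = inner z x], the vector [u = x - z f b] satisfies
[<u, u> = <x, x> - b^* (2 f - f c f) b = <x, x> - b^* b].  Having a single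
vector [u] makes the difference positive by the axioms of a Hilbert module. *)
Lemma cauchy_schwarz_defect x z : rnorm (inner z z) <= 1 ->
  exists u : X, inner u u = inner x x - (inner z x)^`* ** inner z x :> A.
Proof.
set c := inner z z => c1; set b := inner z x.
have [q sq qE] := quadratic_fixpoint c1 (inner_star z z).
set h := (2^-1 : R)%:C%C in qE.
pose w := h *: b + q ** b; exists (x - act z w).
rewrite innerBl !innerBr !inner_actl !inner_act -(inner_star z x) -/b -/c.
have sw : w^`* = h *: b^`* + b^`* ** q by rewrite starD starZ_real star_cmul sq.
have wcw : w^`* ** (c ** w) = b^`* ** q ** b + b^`* ** q ** b.
  rewrite -[RHS]cmulDl -cmulDr qE sw /w !(cmulDr, cmulDl, cmulZl, cmulZr) !cmulA.
  by rewrite !scalerDr !addrA.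
rewrite wcw sw /w cmulDl cmulDr cmulZl cmulZr cmulA.
set P := b^`* ** q ** b; set B := h *: _ + P.
have BB : B + B = b^`* ** b + (P + P) by rewrite /B addrACA half_scaleD.
by rewrite -addrA -opprD addrA BB addrK.
Qed.

Lemma cauchy_schwarz_witness x z (K : R) : rnorm (inner z z) <= K ->
  exists u : X, inner u u = K%:C%C *: inner x x - (inner z x)^`* ** inner z x.
Proof.
move=> zK; have K0 : 0 <= K by exact: le_trans (rnorm_ge0 _) zK.
move: K0; rewrite le_eqVlt => /orP[/eqP K0|K0].
  have z0 : z = 0.
    by apply/inner_eq0/rnorm_eq0/eqP; rewrite eq_le rnorm_ge0 andbT K0.
  exists 0; rewrite -K0 z0 scale0r sub0r -[inner 0 x]inner_star !inner0r.
  by rewrite star0 cmul0r oppr0.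
have Ki : 0 <= K^-1 by rewrite invr_ge0 ltW.
pose z' := (Num.sqrt K^-1)%:C%C *: z.
have [|u uE] := @cauchy_schwarz_defect x z'.
  by rewrite innerZ_real // rnormZ // mulrC ler_pdivrMr ?mul1r.
exists ((Num.sqrt K)%:C%C *: u); rewrite innerZ_real ?ltW // uE scalerBr; congr (_ - _).
rewrite -[inner z' x]inner_star innerZr !starZ_real !inner_star cmulZl cmulZr.
rewrite !scalerA -!rmorphM -expr2 sqr_sqrtr //.
by rewrite divff ?scale1r // lt0r_neq0.
Qed.

End HilbertModule.

(** * Norm of the combined vector *)

Section Estimate.
Context {R : realType}.

Lemma sum_mul_le_sqrt (I : finType) (P : pred I) (u v : I -> R) :
  \sum_(i | P i) u i * v i <=
  Num.sqrt (\sum_(i | P i) u i ^+ 2) * Num.sqrt (\sum_(i | P i) v i ^+ 2).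
Proof.
set U := \sum_(i | P i) u i ^+ 2; set V := \sum_(i | P i) v i ^+ 2.
set W := \sum_(i | P i) _.
have U0 : 0 <= U by apply: sumr_ge0 => i _; exact: sqr_ge0.
have V0 : 0 <= V by apply: sumr_ge0 => i _; exact: sqr_ge0.
rewrite -sqrtrM // (le_trans (ler_norm _)) // -sqrtr_sqr ler_wsqrtr //.
have : 0 <= \sum_(i | P i) \sum_(j | P j) (u i * v j - u j * v i) ^+ 2.
  by apply: sumr_ge0 => i _; apply: sumr_ge0 => j _; exact: sqr_ge0.
have -> : \sum_(i | P i) \sum_(j | P j) (u i * v j - u j * v i) ^+ 2 =
    \sum_(i | P i) (u i ^+ 2 * V + v i ^+ 2 * U - 2 * (u i * v i) * W).
  apply: eq_bigr => i _; rewrite !mulr_sumr -big_split -sumrB /=.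
  by apply: eq_bigr => j _; ring.
rewrite sumrB big_split /= -!mulr_suml -mulr_sumr -/U -/V -/W; nra.
Qed.

(** The diagonal terms are bounded by [m]; the other ones by the Cauchy-Schwarz
inequality over the pairs [i != j], where the sum of the
[(alpha i * alpha j) ^+ 2] is at most [(\sum_i alpha i ^+ 2) ^+ 2]. *)
Lemma sum_gram_le (I : finType) (alpha : I -> R) (G : I -> I -> R) (m : R) :
  (forall i, G i i <= m) ->
  \sum_i \sum_j alpha i * G i j * alpha j <=
  (\sum_i alpha i ^+ 2) *
  (m + Num.sqrt (\sum_i \sum_(j | i != j) G i j ^+ 2)).
Proof.
move=> Gm; rewrite mulrDr; set S := \sum_i alpha i ^+ 2.
have S0 : 0 <= S by apply: sumr_ge0 => i _; exact: sqr_ge0.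
have split_diag (F : I -> I -> R) : \sum_i \sum_j F i j =
    \sum_i F i i + \sum_(p : I * I | p.1 != p.2) F p.1 p.2.
  rewrite -(pair_big_dep xpredT (fun i j => i != j)) /= -big_split /=.
  apply: eq_bigr => i _; rewrite (bigD1 i) //=; congr (_ + _).
  by apply: eq_bigl => j; rewrite eq_sym.
rewrite split_diag lerD //.
  rewrite mulr_suml ler_sum // => i _.
  by rewrite mulrAC -expr2 ler_wpM2l ?sqr_ge0.
rewrite pair_big_dep /=.
have -> : \sum_(p : I * I | p.1 != p.2) alpha p.1 * G p.1 p.2 * alpha p.2 =
    \sum_(p : I * I | p.1 != p.2) (alpha p.1 * alpha p.2) * G p.1 p.2.
  by apply: eq_bigr => p _; rewrite mulrAC.
rewrite (le_trans (sum_mul_le_sqrt _ _ _)) // ler_wpM2r ?sqrtr_ge0 //.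
rewrite -[leRHS](ger0_norm S0) -sqrtr_sqr ler_wsqrtr //.
have -> : S ^+ 2 = \sum_i \sum_j (alpha i * alpha j) ^+ 2.
  rewrite expr2 mulr_suml; apply: eq_bigr => i _; rewrite mulr_sumr.
  by apply: eq_bigr => j _; rewrite exprMn.
by rewrite split_diag lerDr sumr_ge0 // => i _; exact: sqr_ge0.
Qed.

Lemma real_complex_max (x y : R) :
  (Num.max x y)%:C%C = Num.max x%:C%C y%:C%C :> R[i].
Proof. by rewrite /Order.max ltcR; case: ifP. Qed.

Lemma sqrtC_real (x : R) : 0 <= x -> sqrtC (x%:C%C : R[i]) = (Num.sqrt x)%:C%C.
Proof.
move=> x0; rewrite -[in LHS](sqr_sqrtr x0) rmorphXn /= sqrCK //.
by rewrite lecR sqrtr_ge0.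
Qed.

End Estimate.

Lemma rnorm_inner_sum (R : realType) (A : cstarAlgType R) (X : hilbertModType A)
    (n : nat) (y : 'I_n -> X) (a : 'I_n -> A) :
  rnorm (inner (\sum_i act (y i) (a i)^`*) (\sum_i act (y i) (a i)^`*)) <=
  (\sum_i rnorm (a i) ^+ 2) * (\big[Num.max/0]_i (rnorm (y i) ^+ 2) +
    Num.sqrt (\sum_i \sum_(j | i != j) rnorm (inner (y i) (y j)) ^+ 2)).
Proof.
set z := \sum_i act _ _; apply: le_trans (sum_gram_le _ _); last first.
  move=> i; rewrite rnorm_inner; exact: (le_bigmax _ (fun i => rnorm (y i) ^+ 2)).
have -> : inner z z = \sum_i \sum_j a i ** inner (y i) (y j) ** (a j)^`*.
  rewrite inner_suml; apply: eq_bigr => i _; rewrite inner_sumr.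
  by apply: eq_bigr => j _; rewrite inner_act inner_actl starK.
rewrite (le_trans (ler_rnorm_sum _ _ _)) // ler_sum // => i _.
rewrite (le_trans (ler_rnorm_sum _ _ _)) // ler_sum // => j _.
rewrite (le_trans (rnorm_cmul _ _)) // rnorm_star ler_wpM2r ?rnorm_ge0 //.
exact: rnorm_cmul.
Qed.

(** * The inequality *)

Theorem theorem3p8 (R : realType) (A : cstarAlgType R) (X : hilbertModType A)
    (n : nat) (hn : (0 < n)%N) (x : X) (y : 'I_n -> X) (a : 'I_n -> A) :
  cstar_sqr (cstar_abs (\sum_(i < n) a i ** inner (y i) x)) <=*
  ((\sum_(i < n) `|a i| ^+ 2) *
   (\big[Num.max/0]_(i < n) (`|y i| ^+ 2) +
    sqrtC (\sum_(i < n) \sum_(j < n | i != j) `|inner (y i) (y j)| ^+ 2)))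
  *: cstar_sqr (hilbert_abs x).
Proof.
set s := \sum_(i < n) a i ** _; set k := _ * _.
pose z := \sum_(i < n) act (y i) (a i)^`*.
have zs : inner z x = s.
  by rewrite inner_suml; apply: eq_bigr => i _; rewrite inner_actl starK.
pose G2 := \sum_(i < n) \sum_(j < n | i != j) rnorm (inner (y i) (y j)) ^+ 2.
pose K := (\sum_i rnorm (a i) ^+ 2) *
  (\big[Num.max/0]_i (rnorm (y i) ^+ 2) + Num.sqrt G2).
have normX2 (V : normedModType R[i]) (v : V) : `|v| ^+ 2 = (rnorm v ^+ 2)%:C%C.
  by rewrite rnormE rmorphXn.
have kE : k = K%:C%C.
  rewrite /k /K rmorphM rmorphD /= -sqrtC_real; last first.
    by apply: sumr_ge0 => i _; apply: sumr_ge0 => j _; exact: sqr_ge0.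
  congr (_ * (_ + sqrtC _)).
  - by rewrite rmorph_sum; apply: eq_bigr => i _; exact: normX2.
  - rewrite (big_morph _ (@real_complex_max R) (erefl 0%:C%C)).
    by apply: eq_bigr => i _; exact: normX2.
  - rewrite rmorph_sum; apply: eq_bigr => i _; rewrite rmorph_sum.
    by apply: eq_bigr => j _; exact: normX2.
have K0 : 0 <= K := le_trans (rnorm_ge0 _) (rnorm_inner_sum y a).
rewrite /cstar_le /hilbert_abs (cstar_sqrtK (inner_ge0 x)) kE.
(* The square of the absolute value of [s] is [s^`* ** s], or the square of the
   default value [0]; both are dominated. *)
rewrite /cstar_abs /cstar_sqrt; case: xgetP => [b _ [_ b2]|_].
  have [u uE] := cauchy_schwarz_witness x (rnorm_inner_sum y a).
  by rewrite /cstar_sqr b2 -zs -uE; exact: inner_ge0.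
by rewrite /cstar_sqr cmul0l subr0 -innerZ_real //; exact: inner_ge0.
Qed.
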